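(* Let $I\subset\mathbb{R}$ be an open interval and let $\alpha: I\to E^3$ be a smooth unit speed curve with Frenet vectors $T,N,B$ and with nowhere zero curvature $\kappa$ and nowhere zero torsion $\tau$. Let $W=\tau T+\kappa B$ be its Darboux vector. Then $\alpha$ is a Mannheim curve if and only if there is a constant $\lambda$ such that $$\frac{\|T'\|}{\|W\|^{2}}=\frac{\|T'\|}{\|N'\|^{2}}=\lambda$$ on $I$.
   Context: $E^3$ is Euclidean 3-space and primes denote derivatives with respect to the arclength parameter $s$. The Frenet vectors are $T=\alpha'$, $N=T'/\|T'\|$, $B=T\times N$, with $T'=\kappa N$, $N'=-\kappa T+\tau B$, $B'=-\tau N$. The curve $\alpha$ is a Mannheim curve if there is a regular smooth curve $\alpha^*:I\to E^3$ such that at corresponding points $\alpha(s),\alpha^*(s)$ the principal normal line of $\alpha$ coincides with the binormal line of $\alpha^*$. That is, the line through $\alpha(s)$ with direction $N(s)$ contains $\alpha^*(s)$, and $N(s)$ is orthogonal to both $(\alpha^* )'(s)$ and $(\alpha^* )''(s)$ (this formulation also covers points where the curvature of $\alpha^*$ vanishes). *)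

(* Defs.v *)
From HB Require Import structures.
From mathcomp Require Import all_boot all_order all_algebra.
From mathcomp Require Import all_classical all_reals all_analysis.

Set Implicit Arguments.
Unset Strict Implicit.
Unset Printing Implicit Defensive.

Import Order.TTheory GRing.Theory Num.Theory.
Import numFieldNormedType.Exports.

Local Open Scope classical_set_scope.
Local Open Scope ring_scope.

(* The norm `|u| that the library puts on 'rV[R]_3 is the
   sup norm. It induces the usual topology, so the library derivatives of
   curves R -> 'rV[R]_3 are the usual ones, but every length below has to be
   measured with [enorm]. *)

Definition dotv (R : realType) (u v : 'rV[R]_3) : R :=
  \sum_(i < 3) u 0 i * v 0 i.

Definition enorm (R : realType) (u : 'rV[R]_3) : R := Num.sqrt (dotv u u).

(* Indices are in 'I_3, hence modulo 3, so that this is the usual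
   (u_1 v_2 - u_2 v_1, u_2 v_0 - u_0 v_2, u_0 v_1 - u_1 v_0). *)
Definition crossv (R : realType) (u v : 'rV[R]_3) : 'rV[R]_3 :=
  \row_i (u 0 (i + 1) * v 0 (i + 2) - u 0 (i + 2) * v 0 (i + 1)).

Definition line (R : realType) (p v : 'rV[R]_3) : set 'rV[R]_3 :=
  [set q | exists t : R, q = p + t *: v].

(* A curve on I is represented by a function on all of R. The set I is always
   open below, so derivatives at points of I only depend on the values on I,
   and nothing is ever required outside I. *)

Definition smooth_on (R : realType) (I : set R) (c : R -> 'rV[R]_3) : Prop :=
  forall (n : nat) (s : R), I s -> derivable (derive1n n c) s 1.

Definition regular_on (R : realType) (I : set R) (c : R -> 'rV[R]_3) : Prop :=
  forall s : R, I s -> derive1 c s != 0.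

Definition unit_speed_on (R : realType) (I : set R) (c : R -> 'rV[R]_3) : Prop :=
  forall s : R, I s -> enorm (derive1 c s) = 1.

(* The Frenet vectors and coefficients below are those of a unit speed curve. *)

Definition tangent (R : realType) (c : R -> 'rV[R]_3) : R -> 'rV[R]_3 := derive1 c.

Definition normal (R : realType) (c : R -> 'rV[R]_3) (s : R) : 'rV[R]_3 :=
  (enorm (derive1 (tangent c) s))^-1 *: derive1 (tangent c) s.

Definition binormal (R : realType) (c : R -> 'rV[R]_3) (s : R) : 'rV[R]_3 :=
  crossv (tangent c s) (normal c s).

(* The coefficient kappa of T' = kappa N, for N = T' / ||T'||. *)
Definition curvature (R : realType) (c : R -> 'rV[R]_3) (s : R) : R :=
  enorm (derive1 (tangent c) s).

(* The coefficient of B in N' = - kappa T + tau B, as (T, N, B) is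
   orthonormal. *)
Definition torsion (R : realType) (c : R -> 'rV[R]_3) (s : R) : R :=
  dotv (derive1 (normal c) s) (binormal c s).

Definition darboux (R : realType) (c : R -> 'rV[R]_3) (s : R) : 'rV[R]_3 :=
  torsion c s *: tangent c s + curvature c s *: binormal c s.

(* The principal normal line of c at c s coincides with the binormal line of d
   at d s: it contains d s and its direction is orthogonal to d' s and d'' s,
   a form that also makes sense where the curvature of d vanishes. The
   parameter s is the arclength of c, in general not that of d. *)
Definition mannheim_partner (R : realType) (I : set R)
    (c d : R -> 'rV[R]_3) : Prop :=
  forall s : R, I s ->
    [/\ line (c s) (normal c s) (d s),
        dotv (normal c s) (derive1 d s) = 0
      & dotv (normal c s) (derive1n 2 d s) = 0].

Definition mannheim (R : realType) (I : set R) (c : R -> 'rV[R]_3) : Prop :=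
  exists d : R -> 'rV[R]_3,
    [/\ smooth_on I d, regular_on I d & mannheim_partner I c d].

(* Main.v *)
Require Import Defs.
From mathcomp Require Import all_boot all_order all_algebra.
From mathcomp Require Import all_classical all_reals all_analysis.
From mathcomp Require Import ring lra.
Import Order.TTheory GRing.Theory Num.Theory.
Import numFieldNormedType.Exports.
Local Open Scope classical_set_scope.
Local Open Scope ring_scope.

(** Why the theorem holds. Since (T, N, B) is orthonormal and N' has the
    components - kappa, 0 and tau, both ||N'||^2 and ||W||^2 equal
    kappa^2 + tau^2 ([enorm_derive1_normal], [enorm_darboux]). The two ratios
    therefore always agree, and what has to be shown is that alpha is a Mannheim
    curve if and only if kappa = lambda (kappa^2 + tau^2) for a constant lambda.

    A partner d has the form alpha + t N with t = <d - alpha, N>. As N is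
    orthogonal to T, to d' and to N', the derivative of t vanishes, so
    t is a constant lambda on the interval ([mannheim_partner_cst]).
    Conversely, every curve d = alpha + lambda N has d' = T + lambda N', which
    is orthogonal to N; differentiating <N, d'> = 0 gives
    <N, d''> = - <N', d'> = kappa - lambda (kappa^2 + tau^2)
    ([dotv_normal_parallel]). So the condition on d'' is the wanted relation.
    The curve d is regular because <d', B> = lambda tau: where d' vanishes,
    lambda is 0, and then d' = T is a unit vector.

    The analytic point is that d is smooth, that is, that the square root in
    N = T' / ||T'|| does no harm where kappa is nonzero. The function
    f = 1 / sqrt q satisfies f' = - f^3 q' / 2, in which only f itself and q'
    occur, so f gains one derivative at a time as long as q has one
    ([derivable_upto_rsqrt]). *)

(** * Dot and cross products *)

Lemma dotvE {R : realType} (u v : 'rV[R]_3) :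
  dotv u v = u 0 0 * v 0 0 + u 0 1 * v 0 1 + u 0 2 * v 0 2.
Proof.
rewrite /dotv !big_ord_recr big_ord0 /= add0r.
by congr (u _ _ * v _ _ + u _ _ * v _ _ + u _ _ * v _ _); exact: val_inj.
Qed.

Lemma dotvC {R : realType} (u v : 'rV[R]_3) : dotv u v = dotv v u.
Proof. by rewrite !dotvE; ring. Qed.

Lemma dotvDl {R : realType} (u v w : 'rV[R]_3) :
  dotv (u + v) w = dotv u w + dotv v w.
Proof. by rewrite !dotvE !mxE; ring. Qed.

Lemma dotvDr {R : realType} (u v w : 'rV[R]_3) :
  dotv w (u + v) = dotv w u + dotv w v.
Proof. by rewrite dotvC dotvDl !(dotvC w). Qed.

Lemma dotvZl {R : realType} (a : R) (u v : 'rV[R]_3) :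
  dotv (a *: u) v = a * dotv u v.
Proof. by rewrite !dotvE !mxE; ring. Qed.

Lemma dotvZr {R : realType} (a : R) (u v : 'rV[R]_3) :
  dotv u (a *: v) = a * dotv u v.
Proof. by rewrite dotvC dotvZl dotvC. Qed.

Lemma dotv_ge0 {R : realType} (u : 'rV[R]_3) : 0 <= dotv u u.
Proof. by rewrite dotvE -!expr2 !addr_ge0 ?sqr_ge0. Qed.

Lemma enorm_sqr {R : realType} (u : 'rV[R]_3) : enorm u ^+ 2 = dotv u u.
Proof. by rewrite /enorm sqr_sqrtr ?dotv_ge0. Qed.

Lemma crossvE {R : realType} (u v : 'rV[R]_3) :
  [/\ crossv u v 0 0 = u 0 1 * v 0 2 - u 0 2 * v 0 1,
      crossv u v 0 1 = u 0 2 * v 0 0 - u 0 0 * v 0 2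
    & crossv u v 0 2 = u 0 0 * v 0 1 - u 0 1 * v 0 0].
Proof.
split; rewrite mxE;
  by congr (u _ _ * v _ _ - u _ _ * v _ _); exact: val_inj.
Qed.

Lemma dotv_crossl {R : realType} (u v : 'rV[R]_3) : dotv u (crossv u v) = 0.
Proof. by have [e0 e1 e2] := crossvE u v; rewrite dotvE e0 e1 e2; ring. Qed.

Lemma dotv_cross_cross {R : realType} (u v : 'rV[R]_3) :
  dotv (crossv u v) (crossv u v) = dotv u u * dotv v v - dotv u v ^+ 2.
Proof. by have [e0 e1 e2] := crossvE u v; rewrite !dotvE e0 e1 e2; ring. Qed.

(** The square of the triple product of w, u, v is their Gram determinant,
    and for orthonormal u, v the latter is what remains of the squared length of
    w after removing the squared coordinates along u and v. *)
Lemma parseval_cross {R : realType} (u v w : 'rV[R]_3) :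
    dotv u u = 1 -> dotv v v = 1 -> dotv u v = 0 ->
  dotv w w = dotv u w ^+ 2 + dotv v w ^+ 2 + dotv w (crossv u v) ^+ 2.
Proof.
move=> uu vv uv.
have gram : dotv w (crossv u v) ^+ 2 =
    dotv w w * (dotv u u * dotv v v - dotv u v ^+ 2)
    - dotv u w * (dotv u w * dotv v v - dotv u v * dotv v w)
    + dotv v w * (dotv u w * dotv u v - dotv u u * dotv v w).
  by have [e0 e1 e2] := crossvE u v; rewrite !dotvE e0 e1 e2; ring.
by rewrite gram uu vv uv; ring.
Qed.

(** * Functions derivable up to a given order *)

(** Smoothness cut at a finite order, so that closure properties can be proved
    by induction on the order. The codomain is left general because the same
    notion serves for scalar functions and for curves. *)
Definition derivable_upto {R : realType} {V : normedModType R} (I : set R)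
    (n : nat) (f : R -> V) : Prop :=
  forall k s, (k <= n)%N -> I s -> derivable (derive1n k f) s 1.

Lemma derivable_upto0 {R : realType} {V : normedModType R} {I : set R}
    {f : R -> V} :
  derivable_upto I 0 f <-> forall s, I s -> derivable f s 1.
Proof. by split=> [h s|h [|//] s _ Is]; [exact: (h 0%N)|exact: h]. Qed.

Lemma derivable_uptoS {R : realType} {V : normedModType R} {I : set R}
    {n : nat} {f : R -> V} :
  derivable_upto I n.+1 f <->
  (forall s, I s -> derivable f s 1) /\ derivable_upto I n (derive1 f).
Proof.
split=> [h|[h0 h] [|k] s kn Is]; last 2 first.
- exact: h0.
- by rewrite /derive1n iterSr; exact: h.
split=> [s Is|k s kn Is]; first exact: (h 0%N).
by have := h k.+1 s kn Is; rewrite /derive1n iterSr.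
Qed.

Lemma derivable_uptoW {R : realType} {V : normedModType R} {I : set R}
    {m n : nat} {f : R -> V} :
  (m <= n)%N -> derivable_upto I n f -> derivable_upto I m f.
Proof. by move=> mn h k s km; apply: h; exact: leq_trans mn. Qed.

Lemma open_near_eq {R : realType} {V : Type} {I : set R} {f g : R -> V} {s : R} :
  open I -> (forall x, I x -> f x = g x) -> I s -> \near s, f s = g s.
Proof.
move=> oI fg Is.
by apply: filterS (open_nbhs_nbhs (conj oI Is)); exact: fg.
Qed.

Lemma eq_on_derive1 {R : realType} {V : normedModType R} {I : set R}
    {f g : R -> V} {s : R} :
  open I -> (forall x, I x -> f x = g x) -> I s -> derive1 f s = derive1 g s.
Proof.
move=> oI fg Is; rewrite !derive1E; apply: near_eq_derive.
exact: open_near_eq oI fg Is.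
Qed.

Lemma eq_on_derivable {R : realType} {V : normedModType R} {I : set R}
    {f g : R -> V} {s : R} :
  open I -> (forall x, I x -> f x = g x) -> I s ->
  derivable f s 1 -> derivable g s 1.
Proof.
move=> oI fg Is; apply: near_eq_derivable.
exact: open_near_eq oI fg Is.
Qed.

(** Derivatives are known by formulas valid on I only. This transfers
    regularity along such formulas, and openness of I is what makes it work:
    the functions then agree near each point of I. *)
Lemma eq_on_derivable_upto {R : realType} {V : normedModType R} {I : set R}
    {n : nat} {f g : R -> V} :
  open I -> (forall x, I x -> f x = g x) ->
  derivable_upto I n f -> derivable_upto I n g.
Proof.
move=> oI; elim: n f g => [|n IHn] f g fg.
  by rewrite !derivable_upto0 => h s Is; exact: eq_on_derivable oI fg Is (h s Is).
rewrite !derivable_uptoS => -[df hf]; split.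
  by move=> s Is; exact: eq_on_derivable oI fg Is (df s Is).
by apply: (IHn _ _ _ hf) => x; exact: eq_on_derive1.
Qed.

Lemma derive1_addZ {R : realType} {V : normedModType R} {f g : R -> V}
    {a s : R} : derivable f s 1 -> derivable g s 1 ->
  derive1 (fun x => f x + a *: g x) s = derive1 f s + a *: derive1 g s.
Proof.
move=> df dg; rewrite !derive1E -(deriveZ a dg).
exact: deriveD df (derivableZ (k := a) dg).
Qed.

Lemma derivable_upto_cst {R : realType} {V : normedModType R} {I : set R}
  {n : nat} (a : V) : derivable_upto I n (fun=> a).
Proof.
have d (b : V) s : derivable (fun=> b : V) (s : R) 1 by exact: derivable_cst.
elim: n a => [|n IHn] a; first by rewrite derivable_upto0.
rewrite derivable_uptoS; split=> //.
suff -> : derive1 (fun=> a) = fun=> 0 :> V by exact: IHn.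
by apply/funext => x; rewrite derive1E derive_cst.
Qed.

Lemma derivable_uptoD {R : realType} {V : normedModType R} {I : set R}
    {n : nat} {f g : R -> V} : open I ->
  derivable_upto I n f -> derivable_upto I n g ->
  derivable_upto I n (fun s => f s + g s).
Proof.
move=> oI; elim: n f g => [|n IHn] f g.
  by rewrite !derivable_upto0 => df dg s Is; apply: derivableD; auto.
rewrite !derivable_uptoS => -[df hf] [dg hg]; split.
  by move=> s Is; apply: derivableD; auto.
apply: eq_on_derivable_upto oI _ (IHn _ _ hf hg) => // x Ix.
by rewrite !derive1E deriveD; auto.
Qed.

(** The derivative of a product contains the factors themselves as well as
    their derivatives; at order n they are available by lowering the order of
    the hypotheses. *)
Lemma derivable_uptoM {R : realType} {I : set R} {n : nat} {f g : R -> R} :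
    open I ->
  derivable_upto I n f -> derivable_upto I n g ->
  derivable_upto I n (fun s => f s * g s).
Proof.
move=> oI; elim: n f g => [|n IHn] f g.
  rewrite !derivable_upto0 => df dg s Is.
  exact: derivableM (df s Is) (dg s Is).
move=> hf hg; have := hf; have := hg.
rewrite !derivable_uptoS => -[dg hg'] [df hf']; split.
  by move=> s Is; exact: derivableM (df s Is) (dg s Is).
have hfg := IHn _ _ (derivable_uptoW (leqnSn n) hf) hg'.
have hgf := IHn _ _ (derivable_uptoW (leqnSn n) hg) hf'.
apply: eq_on_derivable_upto oI _ (derivable_uptoD oI hfg hgf) => // x Ix.
by rewrite !derive1E (deriveM (df x Ix) (dg x Ix)).
Qed.

(** The derivative is written with the cube of the function itself rather than
    with powers of q, which is the form that the bootstrap below iterates. *)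
Lemma is_derive_rsqrt {R : realType} {q : R -> R} {s : R} :
  0 < q s -> derivable q s 1 ->
  is_derive s 1 (fun x => (Num.sqrt (q x))^-1)
    (- 2^-1 * (Num.sqrt (q s))^-1 ^+ 3 * derive1 q s).
Proof.
move=> qs dq; pose g : R -> R := Num.sqrt \o q.
have dsqrt : derivable (Num.sqrt : R -> R) (q s) 1.
  by have [] := is_derive1_sqrt qs.
have dg : derivable g s 1.
  move: dq dsqrt => /derivable1_diffP dq /derivable1_diffP dsqrt.
  exact/derivable1_diffP/(differentiable_comp dq dsqrt).
have g0 : g s != 0 by rewrite sqrtr_eq0 -ltNge.
have g's : 'D_1 g s = (2 * g s)^-1 * derive1 q s.
  by rewrite -derive1E (derive1_comp dq dsqrt) derive1E (derive_sqrt qs).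
apply: DeriveDef; first exact: (derivableV g0 dg).
rewrite (deriveV g0 dg) g's -[Num.sqrt (q s)]/(g s).
move: (g s) (derive1 q s) g0 => y q' y0; rewrite /GRing.scale /=.
by field.
Qed.

(** Bootstrap: f' is a polynomial in f and q', so if f is derivable up to order
    n and q up to order n + 1, then f' is derivable up to order n, by closure
    under products alone. *)
Lemma derivable_upto_rsqrt {R : realType} {I : set R} {n : nat} {q : R -> R} :
    open I -> (forall s, I s -> 0 < q s) -> derivable_upto I n q ->
  derivable_upto I n (fun s => (Num.sqrt (q s))^-1).
Proof.
move=> oI q0; set f : R -> R := fun s => _.
have df s : I s -> derivable q s 1 -> derivable f s 1.
  by move=> /q0 qs dq; have [] := is_derive_rsqrt qs dq.
elim: n => [|n IHn].
  by rewrite !derivable_upto0 => dq s Is; exact: df Is (dq s Is).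
move=> hq; have := hq; rewrite !derivable_uptoS => -[dq hq'].
have hf := IHn (derivable_uptoW (leqnSn n) hq).
split; first by move=> s Is; exact: df Is (dq s Is).
have hf3 := derivable_uptoM oI (derivable_uptoM oI hf hf) hf.
have := derivable_uptoM oI (derivable_uptoM oI
  (derivable_upto_cst (- 2^-1 : R)) hf3) hq'.
apply: (eq_on_derivable_upto oI) => // x Ix.
have [_ f'x] := is_derive_rsqrt (q0 _ Ix) (dq _ Ix).
by rewrite [RHS]derive1E [RHS]f'x -/(f x); ring.
Qed.

(** * Curves and their coordinates *)

Lemma derivable_coord {R : realType} {c : R -> 'rV[R]_3} {s : R} :
  derivable c s 1 <-> forall i, derivable (fun x => c x 0 i) s 1.
Proof.
rewrite derivable_mxP; split=> h i; first exact: h.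
by move=> j; rewrite (ord1 i).
Qed.

Lemma derive1_coord {R : realType} {c : R -> 'rV[R]_3} {s : R} i :
  derivable c s 1 -> derive1 c s 0 i = derive1 (fun x => c x 0 i) s.
Proof. by move=> dc; rewrite derive1E derive_mx // mxE -derive1E. Qed.

Lemma derivable_upto_coord {R : realType} {I : set R} {n : nat}
    {c : R -> 'rV[R]_3} : open I ->
  derivable_upto I n c <-> forall i, derivable_upto I n (fun s => c s 0 i).
Proof.
move=> oI; elim: n c => [|n IHn] c.
  rewrite derivable_upto0; split=> [h i|h s Is].
    by rewrite derivable_upto0 => s Is; have /derivable_coord := h s Is; exact.
  by apply/derivable_coord => i; have /derivable_upto0 := h i; exact.
rewrite derivable_uptoS IHn; split=> [[dc hc] i|h].
  rewrite derivable_uptoS; split=> [s Is|].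
    by have /derivable_coord := dc s Is; exact.
  by apply: eq_on_derivable_upto oI _ (hc i) => // s Is; rewrite derive1_coord; auto.
have dc s : I s -> derivable c s 1.
  by move=> Is; apply/derivable_coord => i; have /derivable_uptoS[] := h i; auto.
split=> // i; have /derivable_uptoS[_] := h i.
by apply: (eq_on_derivable_upto oI) => // s Is; rewrite derive1_coord; auto.
Qed.

Lemma derivable_uptoZ {R : realType} {I : set R} {n : nat} {f : R -> R}
    {c : R -> 'rV[R]_3} : open I ->
  derivable_upto I n f -> derivable_upto I n c ->
  derivable_upto I n (fun s => f s *: c s).
Proof.
move=> oI hf /(derivable_upto_coord oI) hc; apply/(derivable_upto_coord oI) => i.
apply: (eq_on_derivable_upto oI _ (derivable_uptoM oI hf (hc i))) => x _.
by rewrite mxE.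
Qed.

Lemma derivable_upto_dotv {R : realType} {I : set R} {n : nat}
    {c d : R -> 'rV[R]_3} : open I ->
  derivable_upto I n c -> derivable_upto I n d ->
  derivable_upto I n (fun s => dotv (c s) (d s)).
Proof.
move=> oI /(derivable_upto_coord oI) hc /(derivable_upto_coord oI) hd.
have h i := derivable_uptoM oI (hc i) (hd i).
have := derivable_uptoD oI (derivable_uptoD oI (h 0) (h 1)) (h 2).
by apply: (eq_on_derivable_upto oI) => // x _; rewrite dotvE.
Qed.

Lemma is_derive_dotv {R : realType} {c d : R -> 'rV[R]_3} {s : R} :
  derivable c s 1 -> derivable d s 1 ->
  is_derive s 1 (fun x => dotv (c x) (d x))
    (dotv (derive1 c s) (d s) + dotv (c s) (derive1 d s)).
Proof.
move=> dc dd.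
have h i : is_derive s 1 (fun x => c x 0 i * d x 0 i)
    (derive1 c s 0 i * d s 0 i + c s 0 i * derive1 d s 0 i).
  have /derivable_coord/(_ i) dci := dc.
  have /derivable_coord/(_ i) ddi := dd.
  rewrite (derive1_coord i dc) (derive1_coord i dd) !derive1E.
  apply: DeriveDef; first exact: derivableM dci ddi.
  by rewrite (deriveM dci ddi) addrC [X in X + _]mulrC.
have -> : (fun x => dotv (c x) (d x)) =
    (fun x => c x 0 0 * d x 0 0) + (fun x => c x 0 1 * d x 0 1)
    + (fun x => c x 0 2 * d x 0 2).
  by apply/funext => x; rewrite dotvE.
apply: is_derive_eq (is_deriveD (is_deriveD (h 0) (h 1)) (h 2)) _.
by rewrite !dotvE; ring.
Qed.

(** Every orthogonality relation between Frenet vectors and derivatives comes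
    from differentiating a dot product that is constant on I. *)
Lemma dotv_cst_derive1 {R : realType} {I : set R} {c d : R -> 'rV[R]_3}
    {a s : R} : open I ->
  (forall x, I x -> dotv (c x) (d x) = a) -> I s ->
  derivable c s 1 -> derivable d s 1 ->
  dotv (derive1 c s) (d s) + dotv (c s) (derive1 d s) = 0.
Proof.
move=> oI ca Is dc dd; have [_ <-] := is_derive_dotv dc dd.
by rewrite -derive1E (eq_on_derive1 (g := fun=> a) oI) // derive1E derive_cst.
Qed.

Lemma derive1_eq0_cst {R : realType} {I : set R} {f : R -> R} :
  is_interval I -> (forall s, I s -> is_derive s 1 f 0) ->
  forall x y, I x -> I y -> f x = f y.
Proof.
move=> iI df x y; wlog xy : x y / x <= y => [hw Ix Iy|Ix Iy].
  by case/orP: (le_total x y) => /hw h; [|apply/esym]; exact: h.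
have Ixy z : z \in `[x, y] -> I z by rewrite in_itv /=; exact: iI.
have dfo z : z \in `]x, y[ -> is_derive z 1 f 0.
  by move=> /subset_itv_oo_cc /Ixy /df.
have cf : {within `[x, y], continuous f}.
  apply: derivable_within_continuous => z /Ixy /df dz.
  exact: ex_derive.
have [z _ /eqP] := MVT_segment xy dfo cf.
by rewrite mul0r subr_eq0 => /eqP.
Qed.

(** * Frenet frames *)

Lemma smooth_onP {R : realType} {I : set R} {c : R -> 'rV[R]_3} :
  smooth_on I c <-> forall n, derivable_upto I n c.
Proof.
by split=> [h n k s _|h n s]; [exact: h|exact: (h n n s (leqnn n))].
Qed.

Lemma smooth_on_derivable {R : realType} {I : set R} {c : R -> 'rV[R]_3} {s : R} :
  smooth_on I c -> I s -> derivable c s 1.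
Proof. by move=> cs; exact: cs 0%N s. Qed.

Lemma smooth_tangent {R : realType} {I : set R} {c : R -> 'rV[R]_3} :
  smooth_on I c -> smooth_on I (tangent c).
Proof.
by rewrite !smooth_onP => h n; have /derivable_uptoS[] := h n.+1.
Qed.

Lemma curvature_sqr {R : realType} (c : R -> 'rV[R]_3) s :
  curvature c s ^+ 2 = dotv (derive1 (tangent c) s) (derive1 (tangent c) s).
Proof. exact: enorm_sqr. Qed.

Lemma smooth_normal {R : realType} {I : set R} {c : R -> 'rV[R]_3} :
    open I -> smooth_on I c -> (forall s, I s -> curvature c s != 0) ->
  smooth_on I (normal c).
Proof.
move=> oI /smooth_tangent/smooth_onP cs k0; apply/smooth_onP => n.
have /derivable_uptoS[_ hT'] := cs n.+1.
apply: derivable_uptoZ => //; apply: derivable_upto_rsqrt => //.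
  move=> s /k0 ks; rewrite -curvature_sqr.
  by rewrite lt_neqAle sqr_ge0 eq_sym sqrf_eq0 ks.
exact: derivable_upto_dotv.
Qed.

Lemma derive1_tangent {R : realType} {c : R -> 'rV[R]_3} {s : R} :
  curvature c s != 0 -> derive1 (tangent c) s = curvature c s *: normal c s.
Proof. by move=> k0; rewrite scalerA divff // scale1r. Qed.

Lemma dotv_normal_normal {R : realType} {c : R -> 'rV[R]_3} {s : R} :
  curvature c s != 0 -> dotv (normal c s) (normal c s) = 1.
Proof.
move=> k0; rewrite dotvZl dotvZr -curvature_sqr -/(curvature c s).
by field.
Qed.

Lemma dotv_tangent_tangent {R : realType} {I : set R} {c : R -> 'rV[R]_3} {s : R} :
  unit_speed_on I c -> I s -> dotv (tangent c s) (tangent c s) = 1.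
Proof. by move=> cu /cu cs; rewrite -enorm_sqr cs expr1n. Qed.

Lemma dotv_tangent_normal {R : realType} {I : set R} {c : R -> 'rV[R]_3} {s : R} :
    open I -> smooth_on I c -> unit_speed_on I c -> I s ->
  dotv (tangent c s) (normal c s) = 0.
Proof.
move=> oI /smooth_tangent cs cu Is; have dT := smooth_on_derivable cs Is.
have := dotv_cst_derive1 oI (fun x => dotv_tangent_tangent cu) Is dT dT.
rewrite dotvC => h; rewrite dotvZr.
have -> : dotv (tangent c s) (derive1 (tangent c) s) = 0 by lra.
by rewrite mulr0.
Qed.

Lemma dotv_normal_derive1 {R : realType} {I : set R} {c : R -> 'rV[R]_3} {s : R} :
    open I -> smooth_on I c -> (forall s, I s -> curvature c s != 0) -> I s ->
  dotv (normal c s) (derive1 (normal c) s) = 0.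
Proof.
move=> oI cs k0 Is; have dN := smooth_on_derivable (smooth_normal oI cs k0) Is.
have := dotv_cst_derive1 oI (fun x Ix => dotv_normal_normal (k0 x Ix)) Is dN dN.
by rewrite dotvC => h; lra.
Qed.

(** Differentiate <T, N> = 0: the other term is <T', N> = kappa. *)
Lemma dotv_tangent_derive1_normal {R : realType} {I : set R}
    {c : R -> 'rV[R]_3} {s : R} :
    open I -> smooth_on I c -> unit_speed_on I c ->
    (forall s, I s -> curvature c s != 0) -> I s ->
  dotv (tangent c s) (derive1 (normal c) s) = - curvature c s.
Proof.
move=> oI cs cu k0 Is; have dN := smooth_on_derivable (smooth_normal oI cs k0) Is.
have dT := smooth_on_derivable (smooth_tangent cs) Is.
have := dotv_cst_derive1 oI (fun x => dotv_tangent_normal oI cs cu) Is dT dN.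
rewrite derive1_tangent ?k0 // dotvZl dotv_normal_normal ?k0 // => h; lra.
Qed.

(** The coordinate along B is the torsion by definition, the one along T is
    - kappa, and the one along N is 0 because N has constant length. *)
Lemma enorm_derive1_normal {R : realType} {I : set R}
    {c : R -> 'rV[R]_3} {s : R} :
    open I -> smooth_on I c -> unit_speed_on I c ->
    (forall s, I s -> curvature c s != 0) -> I s ->
  enorm (derive1 (normal c) s) ^+ 2 = curvature c s ^+ 2 + torsion c s ^+ 2.
Proof.
move=> oI cs cu k0 Is; rewrite [LHS]enorm_sqr.
rewrite (parseval_cross (tangent c s) (normal c s)).
- rewrite (dotv_normal_derive1 oI cs k0 Is) -/(binormal c s) -/(torsion c s).
  by rewrite (dotv_tangent_derive1_normal oI cs cu k0 Is); ring.
- exact: dotv_tangent_tangent cu Is.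
- exact: dotv_normal_normal (k0 _ Is).
- exact: dotv_tangent_normal oI cs cu Is.
Qed.

Lemma enorm_darboux {R : realType} {I : set R} {c : R -> 'rV[R]_3} {s : R} :
    open I -> smooth_on I c -> unit_speed_on I c ->
    (forall s, I s -> curvature c s != 0) -> I s ->
  enorm (darboux c s) ^+ 2 = curvature c s ^+ 2 + torsion c s ^+ 2.
Proof.
move=> oI cs cu k0 Is; rewrite [LHS]enorm_sqr /darboux.
rewrite !(dotvDl, dotvDr, dotvZl, dotvZr) (dotvC (binormal c s) (tangent c s)).
rewrite dotv_crossl dotv_cross_cross (dotv_tangent_normal oI cs cu Is).
rewrite (dotv_tangent_tangent cu Is) (dotv_normal_normal (k0 _ Is)).
by ring.
Qed.

(** * Mannheim partners *)

(** The offset t = <d - c, N> has t' = <d' - T, N> + <d - c, N'>. The first term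
    vanishes since N is orthogonal to d' and T, the second since d - c is a
    multiple of N and N is orthogonal to N'. *)
Lemma mannheim_partner_cst {R : realType} {I : set R} {c d : R -> 'rV[R]_3} :
    open I -> is_interval I -> smooth_on I c -> unit_speed_on I c ->
    (forall s, I s -> curvature c s != 0) ->
    smooth_on I d -> mannheim_partner I c d ->
  exists lambda : R, forall s, I s -> d s = c s + lambda *: normal c s.
Proof.
move=> oI iI cs cu k0 ds cd.
pose t s := dotv (d s) (normal c s) - dotv (c s) (normal c s).
have dE s : I s -> d s = c s + t s *: normal c s.
  move=> Is; have [[a da] _ _] := cd s Is.
  rewrite /t da dotvDl dotvZl (dotv_normal_normal (k0 s Is)) mulr1.
  by rewrite addrAC subrr add0r.
have dt s : I s -> is_derive s 1 t 0.
  move=> Is; have dc := smooth_on_derivable cs Is.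
  have dd := smooth_on_derivable ds Is.
  have dN := smooth_on_derivable (smooth_normal oI cs k0) Is.
  have [_ Nd' _] := cd s Is.
  have [t_derivable t's] :=
    is_deriveB (is_derive_dotv dd dN) (is_derive_dotv dc dN).
  apply: DeriveDef; first exact: t_derivable.
  rewrite [LHS]t's {1}(dE s Is) dotvDl dotvZl (dotv_normal_derive1 oI cs k0 Is).
  rewrite (dotvC (derive1 d s)) Nd' -/(tangent c s).
  by rewrite (dotv_tangent_normal oI cs cu Is); ring.
(* The constant is the value of t at some point of I, if there is one. *)
have [[s0 Is0]|I0] := pselect (exists s, I s); last first.
  by exists 0 => s Is; case: I0; exists s.
by exists (t s0) => s Is; rewrite (derive1_eq0_cst iI dt s0 s Is0 Is); exact: dE.
Qed.

Lemma derive1_parallel {R : realType} {I : set R} {c d : R -> 'rV[R]_3}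
    {lambda s : R} :
    open I -> smooth_on I c -> (forall s, I s -> curvature c s != 0) ->
    (forall s, I s -> d s = c s + lambda *: normal c s) -> I s ->
  derive1 d s = tangent c s + lambda *: derive1 (normal c) s.
Proof.
move=> oI cs k0 dE Is; have dc := smooth_on_derivable cs Is.
have dN := smooth_on_derivable (smooth_normal oI cs k0) Is.
rewrite (eq_on_derive1 oI dE Is); exact: derive1_addZ dc dN.
Qed.

Lemma smooth_parallel {R : realType} {I : set R} {c : R -> 'rV[R]_3}
    (lambda : R) :
    open I -> smooth_on I c -> (forall s, I s -> curvature c s != 0) ->
  smooth_on I (fun s => c s + lambda *: normal c s).
Proof.
move=> oI cs k0; have /smooth_onP Ns := smooth_normal oI cs k0.
move: cs => /smooth_onP cs; apply/smooth_onP => n.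
apply: derivable_uptoD => //; apply: derivable_uptoZ => //.
exact: derivable_upto_cst.
Qed.

(** Only the value of <N, d''> depends on lambda. It is obtained from
    <N, d'> = 0 by one differentiation, as <N, d''> = - <N', T + lambda N'>. *)
Lemma dotv_normal_parallel {R : realType} {I : set R} {c d : R -> 'rV[R]_3}
    {lambda : R} :
    open I -> smooth_on I c -> unit_speed_on I c ->
    (forall s, I s -> curvature c s != 0) ->
    (forall s, I s -> d s = c s + lambda *: normal c s) -> smooth_on I d ->
  (forall s, I s -> dotv (normal c s) (derive1 d s) = 0) /\
  forall s, I s -> dotv (normal c s) (derive1n 2 d s) =
    curvature c s - lambda * (curvature c s ^+ 2 + torsion c s ^+ 2).
Proof.
move=> oI cs cu k0 dE ds.
have Nd' s : I s -> dotv (normal c s) (derive1 d s) = 0.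
  move=> Is; rewrite (derive1_parallel oI cs k0 dE Is) dotvDr dotvZr.
  rewrite (dotv_normal_derive1 oI cs k0 Is) dotvC.
  by rewrite (dotv_tangent_normal oI cs cu Is) mulr0 addr0.
split=> // s Is.
have dN := smooth_on_derivable (smooth_normal oI cs k0) Is.
have := dotv_cst_derive1 oI Nd' Is dN (ds 1%N s Is).
rewrite {1}(derive1_parallel oI cs k0 dE Is) dotvDr dotvZr -enorm_sqr.
rewrite (enorm_derive1_normal oI cs cu k0 Is) dotvC.
rewrite (dotv_tangent_derive1_normal oI cs cu k0 Is).
move=> h; rewrite -[derive1n 2 d]/(derive1 (derive1 d)); lra.
Qed.

Theorem theorem12 (R : realType) (I : set R) (alpha : R -> 'rV[R]_3)
    (I_open : open I) (I_interval : is_interval I)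
    (alpha_smooth : smooth_on I alpha)
    (alpha_unit : unit_speed_on I alpha)
    (kappa_neq0 : forall s, I s -> curvature alpha s != 0)
    (tau_neq0 : forall s, I s -> torsion alpha s != 0) :
  mannheim I alpha <->
  exists lambda : R, forall s : R, I s ->
    enorm (derive1 (tangent alpha) s) / enorm (darboux alpha s) ^+ 2
      = enorm (derive1 (tangent alpha) s) / enorm (derive1 (normal alpha) s) ^+ 2 /\
    enorm (derive1 (tangent alpha) s) / enorm (derive1 (normal alpha) s) ^+ 2 = lambda.
Proof.
(* This is ||N'||^2 = ||W||^2, the denominator of both ratios. *)
have N'0 s : I s -> curvature alpha s ^+ 2 + torsion alpha s ^+ 2 != 0.
  move=> Is; rewrite paddr_eq0 ?sqr_ge0 // negb_and.
  by rewrite !sqrf_eq0 kappa_neq0.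
split=> [[d [d_smooth _ partner]]|[lambda ratio]].
  have [lambda dE] := mannheim_partner_cst I_open I_interval alpha_smooth
    alpha_unit kappa_neq0 d_smooth partner.
  exists lambda => s Is.
  rewrite (enorm_darboux I_open alpha_smooth alpha_unit kappa_neq0 Is).
  rewrite (enorm_derive1_normal I_open alpha_smooth alpha_unit kappa_neq0 Is).
  split=> //.
  have [_ /(_ s Is)] := dotv_normal_parallel I_open alpha_smooth alpha_unit
    kappa_neq0 dE d_smooth.
  have [_ _ ->] := partner s Is => /esym/eqP; rewrite subr_eq0 => /eqP.
  by rewrite -/(curvature alpha s) => {1}->; rewrite mulfK ?N'0.
pose d s := alpha s + lambda *: normal alpha s.
have d_smooth : smooth_on I d by exact: smooth_parallel.
have dE s : I s -> d s = alpha s + lambda *: normal alpha s by [].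
have [Nd' Nd''] := dotv_normal_parallel I_open alpha_smooth alpha_unit
  kappa_neq0 dE d_smooth.
exists d; split=> // s Is.
- rewrite (derive1_parallel I_open alpha_smooth kappa_neq0 dE Is).
  apply/eqP => d'0.
  have TT := dotv_tangent_tangent alpha_unit Is.
  (* The component of d' along the binormal is lambda * tau. *)
  have := congr1 (fun v => dotv v (binormal alpha s)) d'0.
  rewrite dotvDl dotvZl dotv_crossl -/(torsion alpha s) add0r.
  rewrite (_ : dotv 0 _ = 0); last by rewrite dotvE !mxE !mul0r !addr0.
  move/eqP; rewrite mulf_eq0 (negbTE (tau_neq0 s Is)) orbF => /eqP l0.
  move: d'0; rewrite l0 scale0r addr0 => T0.
  by move: TT; rewrite T0 dotvE !mxE !mul0r !addr0 => /esym/eqP; rewrite oner_eq0.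
- split; [by exists lambda|exact: Nd'|rewrite Nd'' //].
  have [_ <-] := ratio s Is.
  rewrite (enorm_derive1_normal I_open alpha_smooth alpha_unit kappa_neq0 Is).
  by rewrite divfK ?N'0 // subrr.
Qed.
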